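(* For every $n\ge 1$, $s_n^k(132,321)=n-k-1$ for all $0\le k\le n-1$, and $s_n^n(132,321)=1$.
   Context: $S_n$ denotes the set of permutations of $\{1,\dots,n\}$ written in one-line notation $\pi=\pi_1\pi_2\cdots\pi_n$. For $\alpha\in S_m$, $\pi\in S_n$ contains the pattern $\alpha$ if there are indices $i_1<i_2<\dots<i_m$ such that $\pi_{i_1}\pi_{i_2}\cdots\pi_{i_m}$ is order-isomorphic to $\alpha$; otherwise $\pi$ avoids $\alpha$. For a set $T$ of patterns, $S_n^k(T)$ is the set of $\pi\in S_n$ that have exactly $k$ fixed points (indices $i$ with $\pi_i=i$) and avoid every pattern in $T$; $s_n^k(T)=|S_n^k(T)|$. The braces around $T$ are omitted, e.g. $s_n^k(132,321)=s_n^k(\{132,321\})$. *)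

(* Defs.v *)
From mathcomp Require Import all_boot all_fingroup.

Set Implicit Arguments.
Unset Strict Implicit.
Unset Printing Implicit Defensive.

(* A permutation of {1, ..., n} is an element of 'S_n, i.e. a permutation of
   'I_n = {0, ..., n - 1}: positions and values are both shifted down by one,
   which changes neither fixed points nor pattern containment.  [one_line]
   shifts them back. *)
Definition one_line n (s : 'S_n) : seq nat := [seq (s i).+1 | i <- enum 'I_n].

(* [f] lists the positions i_1 < ... < i_m of the occurrence of [a] in [s]. *)
Definition contains m n (a : 'S_m) (s : 'S_n) : bool :=
  [exists f : {ffun 'I_m -> 'I_n},
     [forall i : 'I_m, forall j : 'I_m, (i < j) ==> (f i < f j)]
  && [forall i : 'I_m, forall j : 'I_m, (s (f i) < s (f j)) == (a i < a j)]].

Definition avoids m n (a : 'S_m) (s : 'S_n) : bool := ~~ contains a s.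

(* A pattern is a permutation together with its length; only membership in a
   list of patterns matters below. *)
Definition pattern := {m : nat & 'S_m}.

Definition Pattern m (a : 'S_m) : pattern := Tagged (fun m => 'S_m) a.

Definition avoids_all n (T : seq pattern) (s : 'S_n) : bool :=
  all (fun a => avoids (tagged a) s) T.

Definition nb_fixed_points n (s : 'S_n) : nat := #|[set i | s i == i]|.

Definition S_avoid n k (T : seq pattern) : {set 'S_n} :=
  [set s | (nb_fixed_points s == k) && avoids_all T s].

Definition s_avoid n k (T : seq pattern) : nat := #|S_avoid n k T|.

Definition p132 : 'S_3 := tperm (inord 1) (inord 2).
Definition p321 : 'S_3 := tperm (inord 0) (inord 2).

Lemma one_line_p132 : one_line p132 = [:: 1; 3; 2].
Proof.
by rewrite /one_line !enum_ordSl (size0nil (size_enum_ord 0)) /= !permE /=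
  -!val_eqE /= !inordK //= !inordK.
Qed.

Lemma one_line_p321 : one_line p321 = [:: 3; 2; 1].
Proof.
by rewrite /one_line !enum_ordSl (size0nil (size_enum_ord 0)) /= !permE /=
  -!val_eqE /= !inordK //= !inordK.
Qed.

(* Main.v *)
Require Import Defs.
From mathcomp Require Import all_boot all_fingroup.
From mathcomp Require Import zify.

(** Positions and values both start at 0 throughout. The permutations avoiding
    132 and 321 are exactly the block swaps

      q, q+1, ..., q+p-1, 0, 1, ..., q-1, p+q, p+q+1, ..., n-1

    with p and q both zero (the identity) or both positive
    ([avoider_is_block_swap] and [block_swap_avoids]). Indeed, let p be the
    position of the value 0 and q the first value. Before position p the values
    increase, since otherwise the final 0 would complete a 321; from position p
    on they increase, since otherwise the initial 0 would start a 132. Finally a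
    value larger than q that comes after position p exceeds everything before
    position p, since otherwise the first value q would start a 132. Hence the
    values before position p, those below q, and those above q that come later,
    are each sorted and arranged in blocks; their exact positions follow by
    counting ([perm_interval_length]).

    A block swap with p, q > 0 fixes precisely the positions from p+q on, so it
    has n-p-q fixed points. For k < n the avoiders with k fixed points therefore
    correspond to the ways of writing n-k = p+q with p, q > 0, and there are
    n-k-1 of those. For k = n only the identity remains. *)

(** * Patterns of length three *)

Lemma contains3P n (a : 'S_3) (s : 'S_n) :
  reflect (exists x y z : 'I_n,
             [/\ x < y, y < z &
               forall i j : 'I_3,
                 (s (tnth [tuple x; y; z] i) < s (tnth [tuple x; y; z] j))
                 = (a i < a j)])
          (contains a s).
Proof.
apply: (iffP existsP) => [[f /andP[/forallP fm /forallP fa]]|].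
  have lt_f (i j : 'I_3) : i < j -> f i < f j.
    by move=> ij; move/forallP: (fm i) => /(_ j); rewrite ij.
  pose o1 : 'I_3 := Ordinal (isT : 1 < 3); pose o2 : 'I_3 := Ordinal (isT : 2 < 3).
  exists (f ord0), (f o1), (f o2); split; [exact: lt_f | exact: lt_f |].
  have fE i : tnth [tuple f ord0; f o1; f o2] i = f i.
    rewrite (tnth_nth (f ord0)).
    by case: i => [[|[|[|//]]] hi] /=; congr (f _); apply: val_inj.
  by move=> i j; rewrite !fE; move/forallP: (fa i) => /(_ j)/eqP.
case=> x [y [z [xy yz H]]].
exists [ffun i => tnth [tuple x; y; z] i].
apply/andP; split; apply/forallP=> i; apply/forallP=> j; rewrite !ffunE; last first.
  by rewrite H.
apply/implyP; rewrite !(tnth_nth x).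
by case: i j => [[|[|[|//]]] hi] [[|[|[|//]]] hj] //= _; apply: ltn_trans yz.
Qed.

Lemma avoids132P n (s : 'S_n) :
  reflect (forall x y z : 'I_n, x < y -> y < z -> ~~ (s x < s z < s y))
          (avoids p132 s).
Proof.
have p132E (i : 'I_3) : p132 i = nth 0 [:: 0; 2; 1] i :> nat.
  by case: i => [[|[|[|//]]] hi]; rewrite permE /= -!val_eqE /= !inordK.
apply: (iffP idP) => [/contains3P av x y z xy yz|av].
  apply/negP=> /andP[h1 h2]; apply: av; exists x, y, z; split=> //.
  move=> i j; rewrite !p132E !(tnth_nth x).
  by case: i j => [[|[|[|//]]] hi] [[|[|[|//]]] hj] /=; lia.
apply/contains3P => -[x [y [z [xy yz H]]]].
have := av x y z xy yz.
have := H ord0 (Ordinal (isT : 2 < 3)).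
have := H (Ordinal (isT : 2 < 3)) (Ordinal (isT : 1 < 3)).
by rewrite !p132E !(tnth_nth x) /= => -> ->.
Qed.

Lemma avoids321P n (s : 'S_n) :
  reflect (forall x y z : 'I_n, x < y -> y < z -> ~~ (s z < s y < s x))
          (avoids p321 s).
Proof.
have p321E (i : 'I_3) : p321 i = nth 0 [:: 2; 1; 0] i :> nat.
  by case: i => [[|[|[|//]]] hi]; rewrite permE /= -!val_eqE /= !inordK.
apply: (iffP idP) => [/contains3P av x y z xy yz|av].
  apply/negP=> /andP[h1 h2]; apply: av; exists x, y, z; split=> //.
  move=> i j; rewrite !p321E !(tnth_nth x).
  by case: i j => [[|[|[|//]]] hi] [[|[|[|//]]] hj] /=; lia.
apply/contains3P => -[x [y [z [xy yz H]]]].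
have := av x y z xy yz.
have := H (Ordinal (isT : 2 < 3)) (Ordinal (isT : 1 < 3)).
have := H (Ordinal (isT : 1 < 3)) ord0.
by rewrite !p321E !(tnth_nth x) /= => -> ->.
Qed.

(** * Permutations and intervals *)

Lemma card_ord_interval n a b :
  b <= n -> #|[set i : 'I_n | a <= i < b]| = b - a.
Proof.
move=> bn; rewrite -sum1_card.
under eq_bigl => i do rewrite inE.
rewrite -(big_mkord (fun i => a <= i < b) (fun=> 1)).
rewrite sum1_count -size_filter.
have -> : [seq i <- index_iota 0 n | a <= i < b] = index_iota a b.
  apply: (irr_sorted_eq ltn_trans ltnn).
  - by apply: sorted_filter; [exact: ltn_trans | exact: iota_ltn_sorted].
  - exact: iota_ltn_sorted.
  - by move=> i; rewrite mem_filter !mem_index_iota; lia.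
by rewrite size_iota.
Qed.

(** This turns order information into exact values: taking [s j] as a bound of
    the interval of values determines [s j] as soon as the positions of the
    smaller values are known to form an interval. *)
Lemma perm_interval_length n (s : 'S_n) a b c d :
  b <= n -> d <= n -> (forall i : 'I_n, (a <= s i < b) = (c <= i < d)) ->
  b - a = d - c.
Proof.
move=> bn dn E; rewrite -(@card_ord_interval n a b bn) -(@card_ord_interval n c d dn).
rewrite -(card_imset [set i : 'I_n | c <= i < d] (@perm_inj _ s)).
apply: eq_card => i; rewrite inE; apply/idP/imsetP => [h|[j + ->]].
  by exists ((s^-1)%g i); rewrite ?permKV // inE -E permKV.
by rewrite inE E.
Qed.

Lemma perm_eq_val n (s : 'S_n) (i j : 'I_n) : (s i == s j :> nat) = (i == j :> nat).
Proof. by rewrite !val_eqE (inj_eq perm_inj). Qed.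

(** * Block swaps *)

Definition block_swap (p q i : nat) : nat :=
  if i < p then i + q else if i < p + q then i - p else i.

Lemma block_swap_perm n p q :
  p + q <= n -> exists s : 'S_n, forall i, s i = block_swap p q i :> nat.
Proof.
move=> pqn.
have lt_n (i : 'I_n) : block_swap p q i < n.
  by have := ltn_ord i; rewrite /block_swap; case: ifP => ?; last case: ifP; lia.
have inj : injective (fun i => Ordinal (lt_n i)).
  move=> i j /(congr1 val) /=; rewrite /block_swap => E; apply: val_inj => /=.
  by move: E; do ! case: ifP => ?; lia.
by exists (perm inj) => i; rewrite permE.
Qed.

Lemma block_swap_avoids n (s : 'S_n) p q :
  (forall i, s i = block_swap p q i :> nat) ->
  avoids_all [:: Pattern p132; Pattern p321] s.
Proof.
move=> E; rewrite /avoids_all /= andbT; apply/andP; split.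
  by apply/avoids132P => x y z; rewrite !E /block_swap; do ! case: ifP => ?; lia.
by apply/avoids321P => x y z; rewrite !E /block_swap; do ! case: ifP => ?; lia.
Qed.

Lemma block_swap_fixed_points n (s : 'S_n) p q :
  0 < p -> 0 < q -> (forall i, s i = block_swap p q i :> nat) ->
  nb_fixed_points s = n - (p + q).
Proof.
move=> p0 q0 E; rewrite /nb_fixed_points -(@card_ord_interval n (p + q) n (leqnn n)).
apply: eq_card => i; rewrite !inE -val_eqE /= E ltn_ord andbT /block_swap.
by do ! case: ifP => ?; lia.
Qed.

Lemma nb_fixed_points_eqn n (s : 'S_n) : (nb_fixed_points s == n) = (s == 1%g).
Proof.
rewrite /nb_fixed_points; apply/eqP/eqP => [E|->].
  have fixT : [set i | s i == i] = setT.
    by apply/eqP; rewrite eqEcard subsetT cardsT card_ord E /=.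
  by apply/permP => i; move: (in_setT i); rewrite -fixT inE perm1 => /eqP.
by rewrite -[RHS]card_ord -cardsT; apply: eq_card => i; rewrite !inE perm1 eqxx.
Qed.

(** The block lengths are the position [p] of the value 0 and the first value [q].
    The order of the values before and after position [p] makes the positions of
    certain intervals of values intervals themselves, and counting does the rest. *)
Lemma avoider_is_block_swap n (s : 'S_n) :
  0 < n -> avoids_all [:: Pattern p132; Pattern p321] s ->
  exists p q, [/\ p + q <= n, (0 < p) = (0 < q) &
                  forall i, s i = block_swap p q i :> nat].
Proof.
move=> n0; rewrite /avoids_all /= andbT => /andP[/avoids132P no132 /avoids321P no321].
pose o : 'I_n := Ordinal n0; pose p : 'I_n := (s^-1)%g o; pose q := s o.
have spE : s p = 0 :> nat by rewrite permKV.
have neq := perm_eq_val n s.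
have inc_before (i j : 'I_n) : i < j -> j < p -> s i < s j.
  by move=> ij jp; have := no321 i j p ij jp; have := neq i j; have := neq j p; lia.
have inc_after (i j : 'I_n) : p <= i -> i < j -> s i < s j.
  move=> pi ij; have := neq i j; have := neq p j; have := neq p i.
  have [pi'|] := ltnP p i; last by lia.
  by have := no132 p i j pi' ij; lia.
have before_lt_after (i j : 'I_n) : i < p -> p <= j -> q < s j -> s i < s j.
  move=> ip pj qj; have := neq i j; have := neq o i; rewrite /= -/q.
  have [i0|] := ltnP o i; last by rewrite /=; lia.
  by have := no132 o i j i0 (leq_trans ip pj); rewrite -/q; lia.
have ge_q (i : 'I_n) : i < p -> q <= s i.
  move=> ip; have := neq o i; have := inc_before o i; rewrite /= -/q.
  by lia.
have s_before (i : 'I_n) : i < p -> s i = i + q :> nat.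
  move=> ip; have /= := @perm_interval_length n s q (s i) 0 i (ltnW (ltn_ord _)) (ltnW (ltn_ord _)).
  suff H (j : 'I_n) : (q <= s j < s i) = (0 <= j < i).
    by move=> /(_ H); have := ge_q i ip; lia.
  have [jp|pj] := ltnP j p.
    have := inc_before i j; have := inc_before j i; have := neq i j; have := ge_q j jp.
    by lia.
  by have := before_lt_after i j ip pj; have := neq o j; rewrite /= -/q; lia.
have s_low (j : 'I_n) : p <= j -> s j < q -> s j = j - p :> nat.
  move=> pj jq.
  have /= := @perm_interval_length n s 0 (s j) p j (ltnW (ltn_ord _)) (ltnW (ltn_ord _)).
  suff H (i : 'I_n) : (0 <= s i < s j) = (p <= i < j) by move=> /(_ H); lia.
  have [ip|pi] := ltnP i p; first by have := ge_q i ip; lia.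
  by have := inc_after i j; have := inc_after j i; have := neq i j; lia.
have s_high (j : 'I_n) : p <= j -> q < s j -> s j = j :> nat.
  move=> pj jq.
  have /= := @perm_interval_length n s 0 (s j) 0 j (ltnW (ltn_ord _)) (ltnW (ltn_ord _)).
  suff H (i : 'I_n) : (0 <= s i < s j) = (0 <= i < j) by move=> /(_ H); lia.
  have [ip|pi] := ltnP i p; first by have := before_lt_after i j ip pj jq; lia.
  by have := inc_after i j; have := inc_after j i; have := neq i j; lia.
have pqE : (0 < p) = (0 < q) by have := neq p o; rewrite /= -/q spE; lia.
(* The entry just before position [p] has value p+q-1: this bounds p+q by n, and
   forces the later values above [q] to be at least p+q. *)
have last_before : 0 < p -> exists2 l : 'I_n, l.+1 = p & s l = l + q :> nat.
  move=> p0; have ln : p.-1 < n by have := ltn_ord p; lia.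
  by exists (Ordinal ln) => /=; [lia | apply: s_before => /=; lia].
exists p, q; split=> //.
  have [p0|] := ltnP 0 p; last by have := ltn_ord p; lia.
  by have [l lp lE] := last_before p0; have := ltn_ord (s l); lia.
move=> j; rewrite /block_swap; case: ltnP => [|pj]; first exact: s_before.
have [jq|qj|jq] := ltngtP (s j) q.
- by rewrite s_low //; move: (s_low j pj jq); case: ifP; lia.
- rewrite s_high //; case: ifP => // jpq.
  have [p0|] := ltnP 0 p; last by lia.
  have [l lp lE] := last_before p0.
  have lp' : l < p by lia.
  by have := before_lt_after l j lp' pj qj; have := s_high j pj qj; lia.
- by have := neq j o; rewrite /= -/q jq; case: ifP; lia.
Qed.

(** * Counting *)

Theorem theorem2p6 (n : nat) (hn : 1 <= n) :
  (forall k : nat, 0 <= k <= n - 1 ->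
     s_avoid n k [:: Pattern p132; Pattern p321] = n - k - 1) /\
  s_avoid n n [:: Pattern p132; Pattern p321] = 1.
Proof.
split=> [k /andP[_ kn]|].
  have ex (j : 'I_(n - k - 1)) :
      exists s : 'S_n, forall i, s i = block_swap (n - k - j.+1) j.+1 i :> nat.
    by apply: block_swap_perm; have := ltn_ord j; lia.
  have [u uE] := fin_all_exists ex.
  have u_inj : injective u.
    (* The value at position 0 recovers the length [q] of the second block. *)
    move=> i j /(congr1 (fun s : 'S_n => val (s (Ordinal hn)))) /=.
    rewrite !uE /block_swap /= => E; apply: val_inj => /=.
    by have := ltn_ord i; have := ltn_ord j; move: E; do ! case: ifP => ?; lia.
  (* The avoiders with [k] fixed points are the values of [u], where [q = j + 1]. *)
  rewrite /s_avoid -[RHS]card_ord -(card_codom u_inj).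
  apply: eq_card => s; rewrite inE; apply/andP/codomP => [[/eqP fk av]|[j ->]].
    have [p [q [pqn pq0 sE]]] := avoider_is_block_swap n s hn av.
    have q0 : 0 < q.
      rewrite lt0n; apply/eqP => q0; move: pq0 sE; rewrite q0 ltnn => p0 sE.
      have : nb_fixed_points s == n.
        rewrite nb_fixed_points_eqn; apply/eqP/permP => i; apply: val_inj.
        by rewrite perm1 /= sE /block_swap; do ! case: ifP => ?; lia.
      by lia.
    have fE : nb_fixed_points s = n - (p + q).
      by apply: block_swap_fixed_points sE; rewrite ?pq0.
    have jn : q.-1 < n - k - 1 by lia.
    exists (Ordinal jn); apply/permP => i; apply: val_inj; rewrite /= sE uE /=.
    by rewrite prednK //; congr block_swap; lia.
  split; last exact: block_swap_avoids (uE j).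
  by rewrite (block_swap_fixed_points n (u j) _ _ _ _ (uE j)) //; have := ltn_ord j; lia.
have av1 : avoids_all [:: Pattern p132; Pattern p321] (1%g : 'S_n).
  by apply: (@block_swap_avoids n _ 0 0) => i; rewrite perm1 /block_swap !ltn0.
rewrite /s_avoid -[RHS](cards1 (1%g : 'S_n)); apply: eq_card => s.
rewrite !inE nb_fixed_points_eqn; case: eqP => [->|_] //.
Qed.
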